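(* Let $T$ be a complete first-order theory and let $0<k<\omega$. If $T$ is $\mathrm{PM}^{(k+1)}$, then $T$ has $\mathrm{IP}_k$.
   Context: Work in a monster model $\mathcal{U}$ of $T$. For $n<\omega$ identify $n$ with $\{0,\dots,n-1\}$. An $n$-pattern is a pair $(\mathcal{C},\mathcal{I})$ with $\mathcal{C},\mathcal{I}\subseteq (\mathcal{P}(n)\times\mathcal{P}(n))\setminus\{(\emptyset,\emptyset)\}$; elements of $\mathcal{C}$ (resp. $\mathcal{I}$) are consistency (resp. inconsistency) conditions. A partitioned formula $\varphi(x;y)$ exhibits $(\mathcal{C},\mathcal{I})$ in $T$ if there are $b_0,\dots,b_{n-1}\in\mathcal{U}^y$ such that for every $(A^+,A^-)\in\mathcal{C}$ the partial type $\{\varphi(x;b_i):i\in A^+\}\cup\{\neg\varphi(x;b_j):j\in A^-\}$ is consistent, and for every $(Z^+,Z^-)\in\mathcal{I}$ the partial type $\{\varphi(x;b_i):i\in Z^+\}\cup\{\neg\varphi(x;b_j):j\in Z^-\}$ is inconsistent. A pattern is reasonable if (i) for all $(Z^+,Z^-)\in\mathcal{I}$ and $(Y^+,Y^-)\in\mathcal{C}$ there is $\epsilon\in\{+,-\}$ with $Z^\epsilon\not\subseteq Y^\epsilon$; (ii) $A^+\cap A^-=\emptyset$ for all $(A^+,A^-)\in\mathcal{C}$; (iii) $Z^+\cap Z^-=\emptyset$ for all $(Z^+,Z^-)\in\mathcal{I}$. A pattern is positive if every condition $(X^+,X^-)\in\mathcal{C}\cup\mathcal{I}$ has $X^-=\emptyset$.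 For $1<m<\omega$, a formula $\varphi(x;y)$ is $\mathrm{PM}^{(m)}$ (in $T$) if for every $n<\omega$ it exhibits in $T$ every reasonable positive $n$-pattern $(\mathcal{C},\mathcal{I})$ such that every $(Z^+,\emptyset)\in\mathcal{I}$ has $|Z^+|=m$; $T$ is $\mathrm{PM}^{(m)}$ if some formula is $\mathrm{PM}^{(m)}$ in $T$. A formula $\varphi(x;y_0,\dots,y_{k-1})$ has $\mathrm{IP}_k$ if there are $(b^j_i)_{i<\omega}$ in $\mathcal{U}^{y_j}$ for $j<k$ and $(a_s)_{s\subseteq\omega^k}$ in $\mathcal{U}^x$ such that $\models\varphi(a_s;b^0_{i_0},\dots,b^{k-1}_{i_{k-1}})$ iff $(i_0,\dots,i_{k-1})\in s$; $T$ has $\mathrm{IP}_k$ if some formula has $\mathrm{IP}_k$ in $T$. *)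

(* Defs.v *)
From mathcomp Require Import all_boot all_classical.
Set Implicit Arguments.
Unset Strict Implicit.
Unset Printing Implicit Defensive.
Local Open Scope classical_set_scope.
Local Open Scope card_scope.

Record language := Language {
  fsym : Type;
  farity : fsym -> nat;
  rsym : Type;
  rarity : rsym -> nat }.

Inductive term (L : language) (V : Type) : Type :=
| Var of V
| App (f : fsym L) of 'I_(farity f) -> term L V.

Arguments Var L {V} _.

(* [formula L V] is the type of L-formulas whose free variables lie in V.
   A quantifier binds the variable [None] of a formula over [option V]. *)
Inductive formula (L : language) (V : Type) : Type :=
| Bot
| Eqn of term L V & term L V
| Rel (r : rsym L) of 'I_(rarity r) -> term L V
| Imp of formula L V & formula L V
| All of formula L (option V).

Arguments Bot {L V}.

Definition Neg (L : language) (V : Type) (phi : formula L V) : formula L V :=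
  Imp phi Bot.

Definition sentence (L : language) := formula L Empty_set.

Fixpoint trename (L : language) (V W : Type) (g : V -> W) (t : term L V) :
    term L W :=
  match t with
  | Var v => Var L (g v)
  | App f ts => @App L W f (fun i => trename g (ts i))
  end.

Fixpoint frename (L : language) (V W : Type) (g : V -> W) (phi : formula L V) :
    formula L W :=
  match phi with
  | Bot => Bot
  | Eqn t u => Eqn (trename g t) (trename g u)
  | Rel r ts => @Rel L W r (fun i => trename g (ts i))
  | Imp phi1 phi2 => Imp (frename g phi1) (frename g phi2)
  | All phi1 => All (frename (omap g) phi1)
  end.

Record structure (L : language) := Structure {
  carrier :> Type;
  carrier_nonempty : inhabited carrier;
  fun_interp : forall f : fsym L, ('I_(farity f) -> carrier) -> carrier;
  rel_interp : forall r : rsym L, ('I_(rarity r) -> carrier) -> Prop }.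

Fixpoint teval (L : language) (M : structure L) (V : Type) (e : V -> M)
    (t : term L V) : M :=
  match t with
  | Var v => e v
  | App f ts => @fun_interp L M f (fun i => teval e (ts i))
  end.

Definition extend (M V : Type) (e : V -> M) (m : M) (v : option V) : M :=
  if v is Some w then e w else m.

Fixpoint sat (L : language) (M : structure L) (V : Type) (e : V -> M)
    (phi : formula L V) : Prop :=
  match phi with
  | Bot => False
  | Eqn t u => teval e t = teval e u
  | Rel r ts => @rel_interp L M r (fun i => teval e (ts i))
  | Imp phi1 phi2 => sat e phi1 -> sat e phi2
  | All phi1 => forall m : M, sat (extend e m) phi1
  end.

Definition theory (L : language) := set (sentence L).

Definition holds (L : language) (M : structure L) (s : sentence L) : Prop :=
  sat (Empty_set_rect (fun=> carrier M)) s.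

Definition model (L : language) (T : theory L) (M : structure L) : Prop :=
  forall s, T s -> holds M s.

Definition entails (L : language) (T : theory L) (s : sentence L) : Prop :=
  forall M : structure L, model T M -> holds M s.

Definition complete (L : language) (T : theory L) : Prop :=
  (exists M : structure L, model T M) /\
  (forall s : sentence L, entails T s \/ entails T (Neg s)).

Definition join (V P M : Type) (a : V -> M) (e : P -> M) (v : V + P) : M :=
  match v with inl x => a x | inr c => e c end.

(* A formula over V + P, together with [e : P -> M], is a formula in the
   variables V with parameters [e c], c in P.  A partial type is a set of such
   formulas; consistency is taken with respect to the elementary diagram of M,
   i.e. it is finite satisfiability in M. *)
Definition realizes (L : language) (M : structure L) (V P : Type) (e : P -> M)
    (p : set (formula L (V + P))) (a : V -> M) : Prop :=
  forall phi, p phi -> sat (join a e) phi.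

Definition consistent (L : language) (M : structure L) (V P : Type)
    (e : P -> M) (p : set (formula L (V + P))) : Prop :=
  forall q, q `<=` p -> finite_set q -> exists a : V -> M, realizes e q a.

Definition card_lt (S T : Type) (A : set S) (B : set T) : Prop :=
  A #<= B /\ ~ (B #<= A).

Definition saturated (L : language) (K : Type) (M : structure L) : Prop :=
  forall A : set M, card_lt A [set: K] ->
  forall (n : nat) (p : set (formula L ('I_n + A))),
    consistent (fun c : A => val c) p ->
    exists a : 'I_n -> M, realizes (fun c : A => val c) p a.

Definition automorphism (L : language) (M : structure L) (g : M -> M) : Prop :=
  [/\ bijective g,
      forall (f : fsym L) (x : 'I_(farity f) -> M),
        g (fun_interp x) = fun_interp (g \o x) &
      forall (r : rsym L) (x : 'I_(rarity r) -> M),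
        rel_interp (g \o x) <-> rel_interp x].

Definition partial_elementary (L : language) (M : structure L) (A : set M)
    (f : A -> M) : Prop :=
  forall phi : formula L A, sat f phi <-> sat (fun c : A => val c) phi.

Definition strongly_homogeneous (L : language) (K : Type) (M : structure L) :
    Prop :=
  forall A : set M, card_lt A [set: K] ->
  forall f : A -> M, partial_elementary f ->
  exists g : M -> M, automorphism g /\ forall c : A, g (val c) = f c.

(* The cardinal bounding the size of "small" sets is represented by a type K.
   It exceeds |L| + aleph_0, the number of L-formulas. *)
Definition monster (L : language) (T : theory L) (U : structure L) : Prop :=
  model T U /\
  exists K : Type,
    [/\ card_lt [set: formula L nat] [set: K],
        saturated K U & strongly_homogeneous K U].

(* The condition (X^+, X^-) is the pair with components [c.1], [c.2]. *)
Definition condition (n : nat) := ({set 'I_n} * {set 'I_n})%type.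

Record pattern (n : nat) := Pattern {
  pcons : {set condition n};
  pincons : {set condition n};
  pcons_nontrivial : (finset.set0, finset.set0) \notin pcons;
  pincons_nontrivial : (finset.set0, finset.set0) \notin pincons }.

Definition reasonable (n : nat) (P : pattern n) : Prop :=
  [/\ forall Z Y : condition n, Z \in pincons P -> Y \in pcons P ->
        ~~ (Z.1 \subset Y.1) \/ ~~ (Z.2 \subset Y.2),
      forall A : condition n, A \in pcons P -> A.1 :&: A.2 = finset.set0 &
      forall Z : condition n, Z \in pincons P -> Z.1 :&: Z.2 = finset.set0].

Definition positive (n : nat) (P : pattern n) : Prop :=
  forall X : condition n, X \in pcons P \/ X \in pincons P ->
    X.2 = finset.set0.

(* The tuples of variables x and y of a partitioned formula phi(x;y) are
   indexed by 'I_p and 'I_q.  [inst phi b] is phi(x;b). *)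
Definition inst (L : language) (U : structure L) (p q : nat)
    (phi : formula L ('I_p + 'I_q)) (b : 'I_q -> U) : formula L ('I_p + U) :=
  frename (fun v => match v with inl x => inl x | inr y => inr (b y) end) phi.

Definition cond_type (L : language) (U : structure L) (p q n : nat)
    (phi : formula L ('I_p + 'I_q)) (b : 'I_n -> 'I_q -> U) (X : condition n) :
    set (formula L ('I_p + U)) :=
  [set inst phi (b i) | i in [set` X.1]] `|`
  [set Neg (inst phi (b j)) | j in [set` X.2]].

Definition exhibits (L : language) (U : structure L) (p q n : nat)
    (phi : formula L ('I_p + 'I_q)) (P : pattern n) : Prop :=
  exists b : 'I_n -> 'I_q -> U,
    (forall A, A \in pcons P -> consistent (@id U) (cond_type phi b A)) /\
    (forall Z, Z \in pincons P -> ~ consistent (@id U) (cond_type phi b Z)).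

Definition formula_PM (L : language) (U : structure L) (m p q : nat)
    (phi : formula L ('I_p + 'I_q)) : Prop :=
  forall (n : nat) (P : pattern n), reasonable P -> positive P ->
    (forall Z, Z \in pincons P -> #|Z.1| = m) -> exhibits U phi P.

Definition PM (L : language) (U : structure L) (m : nat) : Prop :=
  exists (p q : nat) (phi : formula L ('I_p + 'I_q)), formula_PM U m phi.

(* The free variables of phi(x; y_0, ..., y_{k-1}) are indexed by
   'I_p + {j : 'I_k & 'I_(q j)}, where q j is the length of y_j. *)
Definition formula_IP (L : language) (U : structure L) (k p : nat)
    (q : 'I_k -> nat) (phi : formula L ('I_p + {j : 'I_k & 'I_(q j)})) : Prop :=
  exists (b : forall j : 'I_k, nat -> 'I_(q j) -> U)
         (a : set ('I_k -> nat) -> 'I_p -> U),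
    forall (s : set ('I_k -> nat)) (i : 'I_k -> nat),
      sat (join (a s) (fun y => b (tag y) (i (tag y)) (tagged y))) phi <-> s i.

Definition IP (L : language) (U : structure L) (k : nat) : Prop :=
  exists (p : nat) (q : 'I_k -> nat)
         (phi : formula L ('I_p + {j : 'I_k & 'I_(q j)})), formula_IP U phi.

(* Main.v *)
(* If phi(x;y) is PM^(k+1), then psi(y_k; y_0, ..., y_{k-1}), expressing that
   phi(x;y_0), ..., phi(x;y_k) have a common solution x, can be made to hold
   exactly on the edges of any prescribed finite (k+1)-uniform hypergraph.
   Apply this to the (k+1)-partite hypergraph whose first k parts are copies of
   N, whose last part is the power set of N^k, and whose edges are the
   (i_0, ..., i_{k-1}, S) with (i_0, ..., i_{k-1}) in S: psi then shatters a box
   N^k for every N, and saturation produces a shattered omega^k. *)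
Require Import Defs.
From mathcomp Require Import all_boot all_classical.
Set Implicit Arguments.
Unset Strict Implicit.
Unset Printing Implicit Defensive.
Local Open Scope classical_set_scope.
Local Open Scope card_scope.

(** * Renaming of variables and definable sets of assignments *)

Lemma teval_trename (L : language) (M : structure L) (V W : Type) (g : V -> W)
    (e : W -> M) (t : term L V) : teval e (trename g t) = teval (e \o g) t.
Proof.
elim: t => [//|f ts IH] /=; congr (fun_interp _).
by apply/funext => i; exact: IH.
Qed.

Lemma sat_frename (L : language) (M : structure L) (V W : Type) (g : V -> W)
    (e : W -> M) (phi : formula L V) : sat e (frename g phi) = sat (e \o g) phi.
Proof.
elim: phi W g e => {V} [V|V t u|V r ts|V phi1 IH1 phi2 IH2|V phi IH] W g e //=.
- by rewrite !teval_trename.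
- by congr (rel_interp _); apply/funext => i; rewrite teval_trename.
- by rewrite IH1 IH2.
- apply: eq_forall => m; rewrite IH; congr (sat _ phi).
  by apply/funext => -[v|].
Qed.

Section Definable.
Context {L : language} {U : structure L}.

(** Working with sets of assignments up to equivalence avoids writing formulas explicitly:
    connectives and quantifiers are taken in [Prop]. *)
Definition definable (V : Type) (X : set (V -> U)) : Prop :=
  exists phi : formula L V, forall e, sat e phi <-> X e.

Lemma definable_sat V (phi : formula L V) : definable (fun e => sat e phi).
Proof. by exists phi. Qed.

Lemma definable_comp V W (g : V -> W) (X : set (V -> U)) :
  definable X -> definable (fun e => X (e \o g)).
Proof.
by move=> [phi phiX]; exists (frename g phi) => e; rewrite sat_frename.
Qed.

(** Classically [P] is true or false. This lets membership in an arbitrary fixed set occur in a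
    definable condition. *)
Lemma definable_const V (P : Prop) : definable (fun _ : V -> U => P).
Proof.
have [p|np] := pselect P; last by exists Bot; split.
by exists (Neg Bot); split=> /=.
Qed.

Lemma definable_imp V (X Y : set (V -> U)) :
  definable X -> definable Y -> definable (fun e => X e -> Y e).
Proof.
move=> [phi phiX] [psi psiY]; exists (Imp phi psi) => e /=.
by rewrite phiX psiY.
Qed.

Lemma definable_not V (X : set (V -> U)) :
  definable X -> definable (fun e => ~ X e).
Proof. by move=> dX; apply: definable_imp => //; exact: definable_const. Qed.

Lemma definable_and V (X Y : set (V -> U)) :
  definable X -> definable Y -> definable (fun e => X e /\ Y e).
Proof.
move=> dX dY; have [phi phiXY] := definable_not (definable_imp dX (definable_not dY)).
by exists phi => e; rewrite phiXY not_implyE notK.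
Qed.

Lemma definable_iff V (X Y : set (V -> U)) :
  definable X -> definable Y -> definable (fun e => X e <-> Y e).
Proof. by move=> dX dY; apply: definable_and; exact: definable_imp. Qed.

Lemma definable_forall_fin V (I : finType) (X : I -> set (V -> U)) :
  (forall i, definable (X i)) -> definable (fun e => forall i, X i e).
Proof.
move=> dX; suff [phi phiP] : definable (fun e => forall i, i \in enum I -> X i e).
  exists phi => e; rewrite phiP; split=> [h i|h i _]; last exact: h.
  by apply: h; rewrite mem_enum.
elim: (enum I) => [|i s [phi phiP]].
  by exists (Neg Bot); split=> /=.
have [psi psiP] := definable_and (dX i) (ex_intro _ phi phiP).
exists psi => e; rewrite psiP; split=> [[Xi h] j|h].
  by rewrite inE => /predU1P[->|/h].
by split=> [|j js]; apply: h; rewrite inE ?eqxx ?js ?orbT.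
Qed.

Lemma definable_ex1 V (X : set (option V -> U)) :
  definable X -> definable (fun e => exists m, X (extend e m)).
Proof.
move=> /definable_not[phi phiX]; have := definable_not (definable_sat (All phi)).
move=> [psi psiP]; exists psi => e; rewrite psiP /=; split=> [|[m Xm] /(_ m)].
  by move=> /existsNP[m]; rewrite phiX notK => Xm; exists m.
by rewrite phiX; exact.
Qed.

Lemma definable_ex V m (X : set ('I_m + V -> U)) :
  definable X -> definable (fun e => exists a : 'I_m -> U, X (join a e)).
Proof.
elim: m X => [|m IH] X dX.
  have [u] := carrier_nonempty U.
  (* With no variable left to quantify, ['I_0 + V] is just [V]. *)
  pose g (v : 'I_0 + V) : V := match v with
    | inl i => False_rect V (notF (ltn_ord i)) | inr v => v end.
  have [phi phiX] := definable_comp g dX.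
  have gE a (e : V -> U) : e \o g = join a e.
    by apply/funext => -[[]|].
  exists phi => e; rewrite phiX; split=> [|[a]]; last by rewrite -gE.
  by exists (fun=> u); rewrite -gE.
(* Index 0 becomes the bound variable [None]; the other indices shift down to ['I_m]. *)
pose g (v : 'I_m.+1 + V) : option ('I_m + V) := match v with
  | inl i => omap inl (unlift ord0 i) | inr v => Some (inr v) end.
have [phi phiX] := IH _ (definable_ex1 (definable_comp g dX)).
exists phi => e; rewrite phiX; split=> [[a [x Xa]]|[a Xa]].
  exists (fun i => if unlift ord0 i is Some j then a j else x).
  congr (X _): Xa; apply/funext => -[i|v] //=.
  by case: (unlift ord0 i).
exists (fun i => a (lift ord0 i)), (a ord0); congr (X _): Xa.
by apply/funext => -[i|v] //=; case: unliftP => [j|] ->.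
Qed.

End Definable.

(** * Saturation and limits of sequences of assignments *)

Lemma consistent_directed (L : language) (M : structure L) (V P : Type)
    (e : P -> M) (p : set (formula L (V + P))) :
  p !=set0 ->
  (forall phi psi, p phi -> p psi -> exists2 chi, p chi &
     forall a, sat (join a e) chi -> sat (join a e) phi /\ sat (join a e) psi) ->
  (forall phi, p phi -> exists a, sat (join a e) phi) ->
  consistent e p.
Proof.
move=> [phi0 p0] pdir psat q qp /(@finite_seqP {classic _}) [s qE].
(* By directedness one member [chi] of [p] implies the whole finite part, so any solution of [chi]
   realizes it. *)
suff [chi /psat[a chia] h] : exists2 chi, p chi &
    forall a phi, sat (join a e) chi -> phi \in s -> sat (join a e) phi.
  by exists a => phi qphi; apply: (h _ _ chia); rewrite qE in qphi.
have : forall phi, phi \in s -> p phi by move=> phi ?; apply: qp; rewrite qE.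
elim: s {q qp qE} => [|phi s IH] sp; first by exists phi0.
have [|chi pchi h] := IH; first by move=> psi ps; apply: sp; rewrite inE ps orbT.
have [||chi' pchi' h'] := pdir phi chi => //; first by apply: sp; rewrite inE eqxx.
exists chi' => // a psi /h'[aphi achi]; rewrite inE => /predU1P[-> //|].
exact: h.
Qed.

Section Compactness.
Context {L : language} {U : structure L} {K : Type}.
Hypotheses (KL : card_lt [set: formula L nat] [set: K]) (Usat : saturated K U).

Lemma card_lt_range (c : nat -> U) : card_lt (range c) [set: K].
Proof.
have le1 : range c #<= [set: formula L nat].
  apply: card_le_trans (card_image_le _ _) _.
  (* The formulas [v_n = v_n] are pairwise distinct, so there are at least as many formulas as
     natural numbers. *)
  have /inj_card_eq/card_esym : {in [set: nat] &,
      injective (fun n => Eqn (Var L n) (Var L n))} by move=> m n _ _ [].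
  by move=> /card_eqPle[h _]; apply: card_le_trans h _; exact: subset_card_le.
have [leK nleK] := KL; split; first exact: card_le_trans le1 leK.
by move=> /card_le_trans/(_ le1).
Qed.

(** Saturation recast for directed families of definable sets with parameters from a sequence: the
    range of [c] is countable, hence small. *)
Lemma saturated_realize (m : nat) (c : nat -> U) (I : Type)
    (X : I -> set ('I_m + nat -> U)) :
  inhabited I -> (forall i, definable (X i)) ->
  (forall i j, exists l, X l `<=` X i `&` X j) ->
  (forall i, exists a, X i (join a c)) ->
  exists a, forall i, X i (join a c).
Proof.
move=> [i0] dX Xdir Xsat.
pose A := range c; pose cA n : A := exist _ (c n) (mem_set (imageT c n)).
pose e (x : A) : U := val x.
pose g (v : 'I_m + nat) : 'I_m + A :=
  match v with inl i => inl i | inr n => inr (cA n) end.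
have gE a : join a e \o g = join a c by apply/funext => -[].
have [phi phiX] := choice dX.
have phiE i a : sat (join a e) (frename g (phi i)) <-> X i (join a c).
  by rewrite sat_frename gE phiX.
have [|a ap] := Usat (card_lt_range c) (p := range (fun i => frename g (phi i))).
  apply: consistent_directed; first by exists (frename g (phi i0)), i0.
    move=> _ _ [i _ <-] [j _ <-]; have [l lij] := Xdir i j.
    exists (frename g (phi l)) => [|a]; first by exists l.
    by move=> /phiE/lij[? ?]; split; apply/phiE.
  by move=> _ [i _ <-]; have [a aX] := Xsat i; exists a; apply/phiE.
by exists a => i; apply/phiE; apply: ap; exists i.
Qed.

(** Semantic counterpart of having free variables among the first [n]. *)
Definition determined_below (n : nat) (X : set (nat -> U)) : Prop :=
  forall d d', (forall i, (i < n)%N -> d i = d' i) -> X d -> X d'.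

Definition eventually_on (e : nat -> nat -> U) (X : set (nat -> U)) : Prop :=
  exists N0, forall N, (N0 <= N)%N -> X (e N).

(** The first [n] entries of [c] satisfy whatever holds of [e N] for all large [N]: a limit of the
    [e N] without an ultrafilter. *)
Definition limit_below e n (c : nat -> U) : Prop :=
  forall X, definable X -> determined_below n X -> eventually_on e X -> X c.

(** The conditions on the new entry [n] are directed. Each is solvable over [c]: its projection
    along coordinate [n] depends on the first [n] entries only and holds eventually on [e], hence
    holds of [c]. *)
Lemma limit_below_extend e n c : limit_below e n c ->
  exists c', limit_below e n.+1 c' /\ forall i, (i < n)%N -> c' i = c i.
Proof.
move=> cn; pose upd (d : nat -> U) x i := if i == n then x else d i.
pose I := {X : set (nat -> U) |
  [/\ definable X, determined_below n.+1 X & eventually_on e X]}.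
pose g (i : nat) : 'I_1 + nat := if i == n then inl ord0 else inr i.
have gE a d : join a d \o g = upd d (a ord0).
  by apply/funext => i; rewrite /upd /g /=; case: eqP.
have [||||a aX] := @saturated_realize 1 c I (fun X d => sval X (d \o g)).
- constructor; exists setT; split=> //; last by exists 0.
  exact: definable_const.
- by move=> [X XP]; have [dX _ _] := XP; exact: definable_comp.
- move=> [X XP] [Y YP]; have [dX bX [N1 eX]] := XP; have [dY bY [N2 eY]] := YP.
  have XY : [/\ definable (X `&` Y), determined_below n.+1 (X `&` Y) &
      eventually_on e (X `&` Y)].
    split; first exact: definable_and.
      by move=> d d' dd' [/(bX _ _ dd') ? /(bY _ _ dd')].
    by exists (maxn N1 N2) => N; rewrite geq_max => /andP[/eX ? /eY].
  by exists (exist _ (X `&` Y) XY : I).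
- move=> [X XP] /=; have [dX bX [N0 eX]] := XP.
  apply: (cn (fun d => exists a, X (join a d \o g))).
  + exact: definable_ex (definable_comp g dX).
  + move=> d d' dd' [a]; rewrite gE => Xa; exists a; rewrite gE.
    apply: bX Xa => i; rewrite ltnS leq_eqVlt /upd; case: eqP => //= _.
    exact: dd'.
  (* At stage [N] the projection is witnessed by the entry [e N n] itself. *)
  + exists N0 => N /eX XN; exists (fun=> e N n); congr (X _): XN.
    by rewrite gE; apply/funext => i; rewrite /upd; case: eqP => // ->.
exists (upd c (a ord0)); split=> [X dX bX eX|i].
  by have := aX (exist _ X (And3 dX bX eX)); rewrite /= gE.
by rewrite /upd => /ltn_eqF ->.
Qed.

(* Only saturation over countable sets for types in finitely many variables is
   available, so the countable limit is built one coordinate at a time. *)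
Lemma exists_limit (e : nat -> nat -> U) : exists c, forall n, limit_below e n c.
Proof.
have c0P : limit_below e 0 (e 0).
  by move=> X _ bX [N XN]; apply: bX (XN N (leqnn N)).
pose St n := {c | limit_below e n c}.
have step n (c : St n) : {c' : St n.+1 | forall i, (i < n)%N -> sval c' i = sval c i}.
  apply/cid; have [c' [c'n cc']] := limit_below_extend (svalP c).
  by exists (exist _ c' c'n).
pose F := nat_rect St (exist _ _ c0P) (fun n c => sval (step n c)).
have FE n m i : (i < n)%N -> (n <= m)%N -> sval (F m) i = sval (F n) i.
  move=> lt_in; elim: m => [|m IH]; first by rewrite leqn0 => /eqP ->.
  rewrite leq_eqVlt ltnS => /predU1P[-> //|nm].
  rewrite -IH //=; case: (step m (F m)) => /= c' -> //; exact: leq_trans nm.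
(* Diagonal sequence: entry [i] is fixed from stage [i.+1] on, so below [n] it agrees with stage
   [n]. *)
exists (fun i => sval (F i.+1) i) => n X dX bX eX.
apply: bX (svalP (F n) X dX bX eX) => i lt_in; exact: FE.
Qed.

End Compactness.

(** * From patterns to shattered finite boxes, and from these to [formula_IP] *)

Lemma sat_inst (L : language) (U : structure L) (p q : nat)
    (phi : formula L ('I_p + 'I_q)) (b : 'I_q -> U) (x : 'I_p -> U) :
  sat (join x id) (inst phi b) = sat (join x b) phi.
Proof. by rewrite sat_frename; congr (sat _ phi); apply/funext => -[]. Qed.

(** The type of a positive condition is finite, so finite satisfiability already yields a common
    solution. *)
Lemma consistent_positive (L : language) (U : structure L) (p q n : nat)
    (phi : formula L ('I_p + 'I_q)) (b : 'I_n -> 'I_q -> U) (E : {set 'I_n}) :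
  consistent (@id U) (cond_type phi b (E, finset.set0)) <->
  exists x, forall i, i \in E -> sat (join x (b i)) phi.
Proof.
split=> [/(_ _ (@subset_refl _ _))[]|[x xE] psis sub _].
- by rewrite finite_setU; split; apply: finite_image; exact: finite_finpred.
- move=> x xE; exists x => i iE; rewrite -sat_inst.
  by apply: xE; left; exists i.
- exists x => psi /sub[[i iE <-]|[i]]; first by rewrite sat_inst; exact: xE.
  by rewrite /= finset.in_set0.
Qed.

Lemma PM_shatters (L : language) (U : structure L) (k p q : nat)
    (phi : formula L ('I_p + 'I_q)) (N : nat) :
  formula_PM U k.+1 phi ->
  exists b : 'I_k -> 'I_N -> 'I_q -> U,
    forall S : {set {ffun 'I_k -> 'I_N}}, exists y : 'I_q -> U,
    forall f : {ffun 'I_k -> 'I_N},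
      (exists x, sat (join x y) phi /\ forall j, sat (join x (b j (f j))) phi)
      <-> f \in S.
Proof.
move=> PMphi; pose F := {ffun 'I_k -> 'I_N}.
(* Vertices: [k] parts of size [N], and one part consisting of all subsets of the box. *)
pose W : finType := ('I_k * 'I_N + {set F})%type.
pose vertex (u : F * {set F}) (o : option 'I_k) : W :=
  if o is Some j then inl (j, u.1 j) else inr u.2.
pose transv u : {set 'I_#|W|} := [set enum_rank (vertex u o) | o : option 'I_k]%SET.
have vertex_inj u : injective (vertex u).
  by move=> [j|] [j'|] //= [->].
have card_transv u : #|transv u| = k.+1.
  rewrite card_imset ?cardT -?cardE ?card_option ?card_ord //.
  exact: (inj_comp enum_rank_inj (vertex_inj u)).
(* A transversal meets each part once, so inclusion forces equality in every part. Hence no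
   inconsistency condition lies inside a consistency condition. *)
have transv_sub u v : transv u \subset transv v -> u = v.
  move=> /fintype.subsetP uv.
  have mem o : exists o', vertex u o = vertex v o'.
    have /uv/imsetP[o' _ /enum_rank_inj] : enum_rank (vertex u o) \in transv u.
      exact: imset_f.
    by exists o'.
  rewrite [u]surjective_pairing [v]surjective_pairing; congr pair.
    by apply/ffunP => j; have [[j'|] [] //] := mem (Some j) => <- ->.
  by have [[j'|] [] //] := mem None.
pose conds (D : pred (F * {set F})) : {set condition #|W|} :=
  [set (transv u, finset.set0) | u in D]%SET.
have conds0 D : (finset.set0, finset.set0) \notin conds D.
  apply/imsetP => -[u _ [/esym/eqP]].
  by rewrite -cards_eq0 card_transv.
(* Edges, where [f] lies in [S], must be consistent; the other transversals must be inconsistent. *)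
pose P := Pattern (conds0 (fun u => u.1 \in u.2)) (conds0 (fun u => u.1 \notin u.2)).
have [|||b [bC bI]] := PMphi _ P.
- split.
  + move=> _ _ /imsetP[u uD ->] /imsetP[v vD ->] /=; left; apply/negP => /transv_sub uv.
    by move: uD vD; rewrite uv !unfold_in /= => /negP.
  + by move=> _ /imsetP[u uD ->]; rewrite finset.setI0.
  + by move=> _ /imsetP[u uD ->]; rewrite finset.setI0.
- by move=> X [] /imsetP[u uD ->].
- by move=> _ /imsetP[u uD ->]; exact: card_transv.
exists (fun j i => b (enum_rank (inl (j, i) : W))) => S.
exists (b (enum_rank (inr S : W))) => f.
have transvE : consistent (@id U) (cond_type phi b (transv (f, S), finset.set0)) <->
    exists x, sat (join x (b (enum_rank (inr S : W)))) phi /\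
      forall j, sat (join x (b (enum_rank (inl (j, f j) : W)))) phi.
  rewrite consistent_positive; split=> -[x xE]; exists x.
    split=> [|j]; apply: xE; apply/imsetP.
      by exists None; rewrite ?inE.
    by exists (Some j); rewrite ?inE.
  by move=> _ /imsetP[[j|] _ ->] /=; [exact: xE.2|exact: xE.1].
rewrite -transvE; split=> [|fS].
  apply: contraPT => fS; apply: bI; exact: imset_f.
by apply: bC; exact: imset_f.
Qed.

Lemma formula_IP_of_finite (L : language) (U : structure L) (K : Type)
    (k p : nat) (q : 'I_k -> nat)
    (psi : formula L ('I_p + {j : 'I_k & 'I_(q j)})) :
  card_lt [set: formula L nat] [set: K] -> saturated K U ->
  (forall N, exists b : forall j : 'I_k, nat -> 'I_(q j) -> U,
     forall s : set ('I_k -> nat), exists a : 'I_p -> U,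
     forall i : 'I_k -> nat, (forall j, (i j < N)%N) ->
       (sat (join a (fun y => b (tag y) (i (tag y)) (tagged y))) psi <-> s i)) ->
  formula_IP U psi.
Proof.
move=> KL Usat /choice[B BP].
have [u] := carrier_nonempty U.
(* Every coordinate of every parameter tuple gets a number, so the [N]-th array becomes one sequence
   [e N], with default [u] off the codes. *)
pose code (i : 'I_k -> nat) (y : {j : 'I_k & 'I_(q j)}) : nat :=
  pickle (existT (fun j => (nat * 'I_(q j))%type) (tag y) (i (tag y), tagged y)).
pose e N (m : nat) : U :=
  if unpickle m is Some w then
    let w' : {j : 'I_k & (nat * 'I_(q j))%type} := w in
    B N (tag w') (tagged w').1 (tagged w').2
  else u.
have eE N i y : e N (code i y) = B N (tag y) (i (tag y)) (tagged y).
  by rewrite /e /code pickleK.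
pose g i (v : 'I_p + {j : 'I_k & 'I_(q j)}) : 'I_p + nat :=
  match v with inl x => inl x | inr y => inr (code i y) end.
have gE i a d : join a d \o g i = join a (d \o code i).
  by apply/funext => -[].
pose idx n (f : {ffun 'I_k -> 'I_n}) (j : 'I_k) : nat := f j.
(* [shat n s] asks for agreement with [s] on the box of side [n] only: finitely many points, hence
   definable. *)
pose shat n s (d : 'I_p + nat -> U) :=
  forall f : {ffun 'I_k -> 'I_n}, sat (d \o g (idx n f)) psi <-> s (idx n f).
have dshat n s : definable (shat n s).
  apply: definable_forall_fin => f; apply: definable_iff.
    exact: definable_comp (definable_sat psi).
  exact: definable_const.
have [c cP] := exists_limit KL Usat e.
have c_shat n s : exists a, shat n s (join a c).
  (* [M] bounds all codes used by the box of side [n], so only entries below [M.+1] matter and the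
     limit property of [c] applies. *)
  pose M := \max_(w : {ffun 'I_k -> 'I_n} * {j : 'I_k & 'I_(q j)})
    code (idx n w.1) w.2.
  apply: (cP M.+1 (fun d => exists a, shat n s (join a d))).
  - exact: definable_ex.
  - move=> d d' dd' [a ad]; exists a => f; rewrite -ad !gE.
    suff -> : d' \o code (idx n f) = d \o code (idx n f) by [].
    apply/funext => y /=; rewrite dd' // ltnS.
    exact: (leq_bigmax (F := fun w => code (idx n w.1) w.2) (f, y)).
  - exists n => N leN; have [a aP] := BP N s; exists a => f.
    rewrite -aP => [|j]; last exact: leq_trans (ltn_ord (f j)) leN.
    suff -> : join a (e N) \o g (idx n f) =
      join a (fun y => B N (tag y) (idx n f (tag y)) (tagged y)) by [].
    by rewrite gE; congr join; apply/funext => y; rewrite /= eE.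
(* The boxes are nested, so saturation over [c] gives one [a] that is right on all of them. *)
have c_shatter (s : set ('I_k -> nat)) : exists a, forall n, shat n s (join a c).
  apply: (saturated_realize KL Usat (X := fun n => shat n s)) => //.
  move=> m n; exists (maxn m n) => d dP.
  have sub l : (l <= maxn m n)%N -> shat l s d.
    move=> le_l f; pose f' := [ffun j => widen_ord le_l (f j)].
    suff -> : idx l f = idx _ f' by exact: dP.
    by apply/funext => j; rewrite /idx ffunE.
  by split; apply: sub; rewrite ?leq_maxl ?leq_maxr.
have [a aP] := choice c_shatter.
exists (fun j n l => c (pickle (existT (fun j => (nat * 'I_(q j))%type) j (n, l)))), a.
(* A box large enough to contain the point [i]. *)
move=> s i; pose n := (\max_j i j).+1.
have ltin j : (i j < n)%N by rewrite ltnS; exact: leq_bigmax.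
have -> : i = idx n [ffun j => Ordinal (ltin j)].
  by apply/funext => j; rewrite /idx ffunE.
by rewrite -(aP s n) gE.
Qed.

Theorem theorem6p11 (L : language) (T : theory L) (U : structure L) (k : nat) :
  complete T -> monster T U -> (0 < k)%N -> PM U k.+1 -> IP U k.
Proof.
move=> _ [_ [K [KL Usat _]]] _ [p [q [phi PMphi]]].
(* Variable blocks of [psi]: [x] is to be quantified away, the first copy of [y] becomes the object
   variable, and [k] further copies are the parameters. *)
pose g0 (v : 'I_p + 'I_q) : 'I_p + ('I_q + {j : 'I_k & 'I_q}) :=
  match v with inl x => inl x | inr y => inr (inl y) end.
pose g (j : 'I_k) (v : 'I_p + 'I_q) : 'I_p + ('I_q + {j : 'I_k & 'I_q}) :=
  match v with inl x => inl x | inr l => inr (inr (existT _ j l)) end.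
pose Z (d : 'I_p + ('I_q + {j : 'I_k & 'I_q}) -> U) :=
  sat (d \o g0) phi /\ forall j, sat (d \o g j) phi.
have [psi psiP] : definable (fun d => exists x : 'I_p -> U, Z (join x d)).
  apply: definable_ex; apply: definable_and.
    exact: definable_comp (definable_sat phi).
  by apply: definable_forall_fin => j; exact: definable_comp (definable_sat phi).
exists q, (fun=> q), psi; apply: (formula_IP_of_finite KL Usat) => N.
(* Side [N.+1] keeps the index type nonempty, as [inord] requires; indices below [N] are unchanged
   by it. *)
have [b bP] := PM_shatters N.+1 PMphi.
exists (fun j n => b j (inord n)) => s.
pose S : {set {ffun 'I_k -> 'I_N.+1}} :=
  [set f : {ffun 'I_k -> 'I_N.+1} | `[< s (fun j => val (f j)) >]]%SET.
have [a aP] := bP S.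
exists a => i ltiN; pose f := [ffun j => inord (i j) : 'I_N.+1].
have fE : (fun j => val (f j)) = i.
  by apply/funext => j; rewrite ffunE /= inordK // ltnS ltnW.
have -> : s i <-> f \in S.
  by rewrite inE fE; split=> /asboolP.
rewrite -aP psiP -propeqE; apply: eq_exists => x; congr (_ /\ _).
  by congr sat; apply/funext => -[].
apply: eq_forall => j; congr sat; apply/funext => -[//|l] /=.
by rewrite ffunE.
Qed.
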